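(* Let $\Sigma\subset\mathbb{R}^2$ be a domain, $f:\Sigma\to\mathbb{R}^3$ a front and $p\in\Sigma$ a cuspidal edge of $f$. Then the Gaussian curvature $K$ of $f$ is rationally bounded at $p$ if and only if a parabolic curve of $f$ passes through $p$. Moreover, $K$ is rationally continuous at $p$ if the singular curve passing through $p$ has at least $2$-point contact at $p$ with a parabolic curve.
   Context: Fronts. A $C^\infty$ map $f:\Sigma\to\mathbb{R}^3$ from a domain $\Sigma\subset\mathbb{R}^2$ is a front if there is a $C^\infty$ unit vector field $\nu:\Sigma\to S^2$ with $\langle df_q(X),\nu(q)\rangle=0$ for all $q\in\Sigma$, $X\in T_q\Sigma$, and $(f,\nu):\Sigma\to\mathbb{R}^3\times S^2$ is an immersion. Singular points are the points $q$ with $\operatorname{rank} df_q<2$; $S(f)$ is their set. A singular point $p$ is a cuspidal edge if the germ of $f$ at $p$ is $\mathcal A$-equivalent (equal up to diffeomorphism germs of source and target) to $(u,v)\mapsto(u,v^2,v^3)$ at $0$. Then near $p$ the set $S(f)$ is the image of a regular curve $\gamma$, $\gamma(0)=p$ (the singular curve). An adapted coordinate system centered at $p$ is a local coordinate system $(U;u,v)$ such that the $u$-axis gives the singular curve, $f_v=0$ on the $u$-axis, and there are no singular points off the $u$-axis. Parabolic curve. At each regular point near $p$ there are two principal curvatures with respect to $\nu$. It is known that there is a unique $C^\infty$ function $\kappa$ on a neighborhood of $p$ whose value at every regular point is one of the two principal curvatures (the bounded principal curvature). Points of $\kappa^{-1}(0)$ are parabolic points and $\kappa^{-1}(0)$ is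 the parabolic curve; it passes through $p$ when $\kappa(p)=0$. Contact. A regular plane curve $\alpha$ has at least $(k+1)$-point contact at $t_0$ with the curve $F^{-1}(0)$ (with $F$ a smooth function) if $g(t)=F(\alpha(t))$ satisfies $g(t_0)=g'(t_0)=\cdots=g^{(k)}(t_0)=0$. For contact with the parabolic curve one takes $F=\kappa$. Rational boundedness. Let $(U;u,v)$ be an adapted coordinate system centered at $p$. A function $\psi$ defined on $U\setminus S(f)$ is rationally bounded at $p$ if there are finitely many angles $\theta_1,\dots,\theta_n$ such that for every $\theta\in[0,2\pi)\setminus\{\theta_1,\dots,\theta_n\}$ the finite limit $\lim_{r\to+0}\psi(r\cos\theta,r\sin\theta)$ exists and is a continuous function of $\theta$ there; it is rationally continuous at $p$ if, in addition, this limit does not depend on $\theta$. The Gaussian curvature $K$ is defined on the regular points of $f$. *)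

(* Defs.v *)
From HB Require Import structures.
From mathcomp Require Import all_boot all_order all_algebra.
From mathcomp Require Import all_classical all_reals all_analysis.

Set Implicit Arguments.
Unset Strict Implicit.
Unset Printing Implicit Defensive.

Import Order.TTheory GRing.Theory Num.Theory.
Import numFieldNormedType.Exports.

Local Open Scope classical_set_scope.
Local Open Scope ring_scope.

Section Smooth.
Context {R : realType}.

Definition iter_derive (V W : normedModType R) (vs : seq V) (f : V -> W) : V -> W :=
  foldr (fun v g x => 'D_v g x) f vs.

(* C^oo as infinite differentiability: f and all its iterated directional
   derivatives are (Frechet) differentiable on U, which is meant to be open.
   Maps are total functions; their values outside U are irrelevant. *)
Definition smooth_on (V W : normedModType R) (U : set V) (f : V -> W) : Prop :=
  forall vs x, U x -> differentiable (iter_derive vs f) x.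

Definition diffeo_on (V W : normedModType R) (A : set V) (B : set W)
    (phi : V -> W) : Prop :=
  [/\ open A, open B, smooth_on A phi &
    exists psi : W -> V,
      [/\ smooth_on B psi,
          forall x, A x -> B (phi x) /\ psi (phi x) = x &
          forall y, B y -> A (psi y) /\ phi (psi y) = y]].

End Smooth.

Section Fronts.
Context {R : realType}.
Local Notation plane := ('rV[R]_2).
Local Notation space := ('rV[R]_3).

Definition domain (Sigma : set plane) : Prop := open Sigma /\ connected Sigma.

(* Euclidean inner product: the norm `|u| of the library is the sup norm. *)
Definition dotp n (u v : 'rV[R]_n) : R := (u *m v^T) 0 0.

Definition pt (u v : R) : plane := \row_(j < 2) (if j == 0 then u else v).

(* f is a front on Sigma with unit normal vector field nu. *)
Definition front_with_normal (Sigma : set plane) (f nu : plane -> space) : Prop :=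
  [/\ smooth_on Sigma f, smooth_on Sigma nu,
      forall q, Sigma q -> dotp (nu q) (nu q) = 1,
      forall q X, Sigma q -> dotp ('d f q X) (nu q) = 0 &
      forall q, Sigma q -> injective ('d (fun x => (f x, nu x)) q)].

Definition singular_set (Sigma : set plane) (f : plane -> space) : set plane :=
  [set q | Sigma q /\ (\rank ('J f q) < 2)%N].

Definition standard_cuspidal_edge (w : plane) : space :=
  \row_(j < 3) nth 0 [:: w 0 0; w 0 1 ^+ 2; w 0 1 ^+ 3] j.

(* The germ of f at p is A-equivalent to that of the standard map at 0. *)
Definition cuspidal_edge (Sigma : set plane) (f : plane -> space) (p : plane) : Prop :=
  exists (V U : set plane) (phi : plane -> plane)
         (A B : set space) (Phi : space -> space),
    [/\ diffeo_on V U phi, V 0 /\ phi 0 = p, U `<=` Sigma,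
        diffeo_on A B Phi &
        forall w, V w -> A (standard_cuspidal_edge w) /\
                         f (phi w) = Phi (standard_cuspidal_edge w)].

(* The coordinate system is given by its inverse phi : V -> U, so that
   (u, v) in V are the coordinates of the point phi (pt u v). *)
Definition adapted_coordinates (Sigma : set plane) (f : plane -> space)
    (p : plane) (V U : set plane) (phi : plane -> plane) : Prop :=
  [/\ diffeo_on V U phi, U `<=` Sigma, V 0 /\ phi 0 = p,
      forall u v, V (pt u v) -> (singular_set Sigma f (phi (pt u v)) <-> v = 0) &
      forall u, V (pt u 0) -> 'D_(pt 0 1) (f \o phi) (pt u 0) = 0].

(* Parametrizations by ]-e, e[ of the singular set near p. *)
Definition singular_curve (Sigma : set plane) (f : plane -> space) (p : plane)
    (gamma : R -> plane) : Prop :=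
  exists2 e : R, 0 < e &
    [/\ smooth_on (`]- e, e[ : set R) gamma,
        forall t, - e < t < e -> derive1 gamma t != 0,
        gamma 0 = p &
        exists N : set plane, [/\ open N, N p &
          N `&` singular_set Sigma f = gamma @` `]- e, e[]].

(* Eigenvalues of the shape operator - (df_q)^-1 o dnu_q, for q regular. *)
Definition principal_curvature (f nu : plane -> space) (q : plane) (k : R) : Prop :=
  exists2 X : plane, X != 0 & 'd nu q X = - k *: 'd f q X.

Definition bounded_principal_curvature (Sigma : set plane) (f nu : plane -> space)
    (p : plane) (kappa : plane -> R) : Prop :=
  exists N : set plane,
    [/\ open N, N p, N `<=` Sigma, smooth_on N kappa &
        forall q, N q -> ~ singular_set Sigma f q ->
          principal_curvature f nu q (kappa q)].

Definition parabolic_curve (kappa : plane -> R) : set plane :=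
  [set q | kappa q = 0].

(* At least (k+1)-point contact of alpha at t0 with the zero set of F. *)
Definition contact (k : nat) (alpha : R -> plane) (t0 : R) (F : plane -> R) : Prop :=
  forall i, (i <= k)%N -> derive1n i (F \o alpha) t0 = 0.

(* The rows of 'J f q are the partial derivatives of f at q. *)
Definition first_form (f : plane -> space) (q : plane) : 'M[R]_2 :=
  'J f q *m ('J f q)^T.

Definition second_form (f nu : plane -> space) (q : plane) : 'M[R]_2 :=
  - ('J f q *m ('J nu q)^T).

(* Meaningful at regular points only (the denominator vanishes elsewhere). *)
Definition gauss_curvature (f nu : plane -> space) (q : plane) : R :=
  \det (second_form f nu q) / \det (first_form f q).

(* l is the limit of psi along the ray of angle theta. As psi is only defined
   on D, the ray has to lie in D near the origin. *)
Definition ray_limit (D : set plane) (psi : plane -> R) (theta l : R) : Prop :=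
  (\forall r \near 0^'+, D (pt (r * cos theta) (r * sin theta))) /\
  psi (pt (r * cos theta) (r * sin theta)) @[r --> 0^'+] --> l.

Definition angles_but (s : seq R) : set R :=
  [set theta | 0 <= theta < 2 * pi /\ theta \notin s].

Definition has_ray_limits (D : set plane) (psi : plane -> R) (s : seq R)
    (l : R -> R) : Prop :=
  (forall theta, angles_but s theta -> ray_limit D psi theta (l theta)) /\
  {within angles_but s, continuous l}.

Definition rationally_bounded (D : set plane) (psi : plane -> R) : Prop :=
  exists s l, has_ray_limits D psi s l.

Definition rationally_continuous (D : set plane) (psi : plane -> R) : Prop :=
  exists s l, has_ray_limits D psi s l /\
    (forall theta1 theta2, angles_but s theta1 -> angles_but s theta2 ->
       l theta1 = l theta2).

End Fronts.

(* Main.v *)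
Require Import Defs.
From HB Require Import structures.
From mathcomp Require Import all_boot all_order all_algebra.
From mathcomp Require Import all_classical all_reals all_analysis.
From mathcomp Require Import ring lra.
Import Order.TTheory GRing.Theory Num.Theory.
Import numFieldNormedType.Exports.
Local Open Scope classical_set_scope.
Local Open Scope ring_scope.

Set Implicit Arguments.
Unset Strict Implicit.
Unset Printing Implicit Defensive.

(** Write g and n for the front and its normal in the adapted coordinates
(u, v), and k for the bounded principal curvature there.

Off the u-axis the Gaussian curvature is the product of k and of the other
principal curvature k2, so everything rests on the size of k2.  The two
curvatures are the roots of the characteristic equation of the pair of
fundamental forms ([principal_curvature_eq]), whose sum is a quotient of
polynomials in the inner products of the partial derivatives g_u, g_v, n_u, n_v;
k2 is that quotient minus the bounded k.  Since g_v vanishes on the u-axis, along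
the ray r (c, s) one has g_v = r (s g_vv(0) + o(1)): the numerator is of order r,
the denominator, which is the Gram determinant of g_u and g_v, is of order r^2,
and r k2 tends to C / s with C = - |g_u|^2 (g_vv . n_v) / Gram(g_u, g_vv) taken
at the origin ([cvg_scaled_curvature], [gauss_curvature_ray]).

The constant C is finite and nonzero.  The vectors g_u and g_vv are independent
at the origin because f is a cuspidal edge and not a more degenerate singular
point ([cuspidal_edge_free]).  The front condition makes n_v nonzero; n_v is
orthogonal to n, and also to g_u by the symmetry of second derivatives
([young]), hence it is not orthogonal to g_vv ([gvv_nv]).

So K = (k / r) (r k2) on the ray.  If k(0) is nonzero, K blows up along every
ray with s <> 0; if k(0) = 0, then k / r tends to c k_u + s k_v and K tends to
(c k_u + s k_v) C / s, which is continuous in the angle away from s = 0.  This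
limit does not depend on the angle as soon as k_u(0) = 0, and that is what
two-point contact says: in the coordinates the singular curve runs along the
u-axis with nonzero velocity ([contact_kappa_u]). *)

(** * Differentiability in coordinates *)

Section Calculus.
Context {R : realType}.
Implicit Types V W : normedModType R.

(** Lets a formula for a derivative that is valid only on an open set be
differentiated once more. *)
Lemma near_eq_differentiable V W (f g : V -> W) x :
  (\near x, f x = g x) -> differentiable f x -> differentiable g x.
Proof.
move=> fg dfx.
have exp : g \o shift x = cst (g x) + 'd f x +o_ 0 id.
  apply/eqaddoP => e e0.
  have /eqaddoP/(_ e e0) := diff_locally dfx.
  have fg0 : \forall h \near (0 : V), f (h + x) = g (h + x).
    by move: fg; rewrite (near_shift 0) subr0.
  have fgx := nbhs_singleton fg.
  apply: filter_app; near=> h.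
  rewrite (_ : (g \o shift x - _) h = (f \o shift x - (cst (f x) + 'd f x)) h)//.
  by rewrite /= !fctE /= /cst fgx (near fg0 h).
have gf : 'd g x = 'd f x :> (V -> W).
  by apply: diff_unique exp; exact: diff_continuous.
by apply/diff_locallyP; rewrite gf; split => //; exact: diff_continuous.
Unshelve. all: by end_near. Qed.

Lemma differentiable_rV V n (F : V -> 'rV[R]_n) x :
  (forall j, differentiable (fun y => F y 0 j) x) -> differentiable F x.
Proof.
move=> dF.
rewrite (_ : F = \sum_(j < n) (fun y => F y 0 j *: 'e_j)).
  by apply: differentiable_sum => j; exact: differentiableZl.
by apply/funext => y; rewrite fct_sumE [LHS]row_sum_delta.
Qed.

Lemma differentiable_coordF V n (F : V -> 'rV[R]_n) j x :
  differentiable F x -> differentiable (fun y => F y 0 j) x.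
Proof.
by move=> dF; apply: (@differentiable_comp _ _ _ _ F (fun M => M 0 j)) => //;
  exact: differentiable_coord.
Qed.

Lemma derive_coordF V n (F : V -> 'rV[R]_n) j x v :
  differentiable F x -> 'D_v (fun y => F y 0 j) x = ('D_v F x) 0 j.
Proof.
move=> dF; rewrite [in RHS]derive_mx ?mxE //; exact: diff_derivable.
Qed.

Lemma derive_comp (U V W : normedModType R) (h : U -> V) (f : V -> W) x v :
  differentiable h x -> differentiable f (h x) ->
  'D_v (f \o h) x = 'd f (h x) ('D_v h x).
Proof.
move=> dh df; rewrite !deriveE//; last exact: differentiable_comp.
by rewrite diff_comp.
Qed.

Lemma diff_rV n W (f : 'rV[R]_n -> W) x v :
  differentiable f x -> 'd f x v = \sum_(i < n) v 0 i *: 'D_('e_i) f x.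
Proof.
move=> df; rewrite {1}(row_sum_delta v) linear_sum; apply: eq_bigr => i _.
by rewrite linearZ deriveE.
Qed.

End Calculus.

(** * Second derivatives and their symmetry *)

Section SecondOrder.
Context {R : realType}.
Implicit Types V W : normedModType R.

(** The part of smoothness that the proof uses.  Unlike smoothness itself, it is
seen to be stable under composition from a single chain rule. *)
Definition diff2_on V W (U : set V) (f : V -> W) : Prop :=
  forall x, U x -> differentiable f x /\ forall v, differentiable ('D_v f) x.

Lemma smooth_diff2 V W (U : set V) (f : V -> W) : smooth_on U f -> diff2_on U f.
Proof.
by move=> sf x Ux; split=> [|v]; [exact: (sf [::])|exact: (sf [:: v])].
Qed.

Lemma diff2_comp V m k (A : set V) (B : set 'rV[R]_m) (h : V -> 'rV[R]_m)
    (f : 'rV[R]_m -> 'rV[R]_k) :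
  open A -> diff2_on A h -> diff2_on B f -> (forall x, A x -> B (h x)) ->
  diff2_on A (f \o h).
Proof.
move=> oA d2h d2f AB x Ax; have [dh d2hx] := d2h x Ax.
have [df d2fx] := d2f _ (AB x Ax).
split=> [|v]; first exact: differentiable_comp.
pose F y := \sum_(i < m) ('D_v h y) 0 i *: 'D_('e_i) f (h y).
apply: (@near_eq_differentiable _ _ _ F).
  have : \near x, A x by exact: open_nbhs_nbhs.
  apply: filterS => y Ay; have [dfy _] := d2f _ (AB y Ay).
  by have [dhy _] := d2h y Ay; rewrite (derive_comp v dhy dfy) diff_rV.
apply: differentiable_rV => j.
rewrite (_ : (fun y => _) = \sum_(i < m)
    (fun y => ('D_v h y) 0 i * ('D_('e_i) f (h y)) 0 j)).
  apply: differentiable_sum => i; apply: differentiableM.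
    by apply: (@differentiable_coordF _ _ _ ('D_v h)); exact: d2hx.
  apply: (@differentiable_coordF _ _ _ ('D_('e_i) f \o h)).
  exact: differentiable_comp.
by apply/funext => y; rewrite fct_sumE /F summxE; apply: eq_bigr => i _; rewrite mxE.
Qed.

(** The second difference is the increment over [0, h] of a function phi of one
variable, whose derivative is a difference of two values of D_u G; the mean value theorem
then leaves only the first order expansion of D_u G at x, so that no continuity
of second derivatives is involved. *)
Lemma second_difference_cvg V (G : V -> R) x u v :
  (\near x, differentiable G x) -> differentiable ('D_u G) x ->
  (G (x + h *: u + h *: v) - G (x + h *: u) - G (x + h *: v) + G x) / h ^+ 2
    @[h --> 0^'+] --> 'D_v ('D_u G) x.
Proof.
move=> dG ddG; rewrite deriveE//; set P := 'D_u G; set L := 'd P x.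
(* The points x + s u + t v with 0 <= s, t <= h lie within h C of x; for the two
   such points that enter the estimate, h C bounds the sum of the distances. *)
pose C := (2 * `|u| + `|v|) + 1.
have C0 : 0 < C by rewrite ltr_wpDl// addr_ge0// mulr_ge0.
apply/cvgrPdist_le => e e0.
have /eqaddoP/(_ (e / C)) := diff_locally ddG.
rewrite divr_gt0// => /(_ isT) /nbhs_ballP[d1 /= d10 Hd1].
have /nbhs_ballP[d2 /= d20 Hd2] := dG.
pose d := Num.min d1 d2.
have d0 : 0 < d by rewrite lt_min d10.
near=> h.
have h0 : 0 < h by near: h; exact: nbhs_right_gt.
have hC : h * C < d.
  by rewrite -ltr_pdivlMr//; near: h; apply: nbhs_right_lt; exact: divr_gt0.
have small (s t : R) : 0 <= s <= h -> 0 <= t <= h -> `|s *: u + t *: v| < d.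
  move=> /andP[s0 sh] /andP[t0 th]; apply: le_lt_trans hC.
  rewrite (le_trans (ler_normD _ _))// !normrZ !ger0_norm//.
  have su : s * `|u| <= h * `|u| by rewrite ler_wpM2r.
  have tv : t * `|v| <= h * `|v| by rewrite ler_wpM2r.
  have hu : 0 <= h * `|u| by rewrite mulr_ge0// ltW.
  by rewrite /C; lra.
have dGs (s t : R) : 0 <= s <= h -> 0 <= t <= h ->
    differentiable G (x + s *: u + t *: v).
  move=> sh th; apply: Hd2; rewrite -ball_normE/= -addrA opprD addrA subrr.
  rewrite sub0r normrN.
  by rewrite (lt_le_trans (small _ _ sh th))// ge_min lexx orbT.
have Pd (s t : R) : 0 <= s <= h -> 0 <= t <= h ->
    `|P (x + s *: u + t *: v) - P x - L (s *: u + t *: v)| <=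
    e / C * `|s *: u + t *: v|.
  move=> sh th; have := Hd1 (s *: u + t *: v).
  rewrite -ball_normE/= sub0r normrN.
  move=> /(_ (lt_le_trans (small _ _ sh th) _)); rewrite ge_min lexx.
  move=> /(_ isT); congr (is_true (`|_| <= _)).
  rewrite -[LHS]/(P (s *: u + t *: v + x) - (P x + L (s *: u + t *: v))).
  by rewrite opprD addrA [_ + x]addrC addrA.
pose phi t := G (x + t *: u + h *: v) - G (x + t *: u).
have hh : 0 <= h <= h by apply/andP; split=> //; exact: ltW.
have zh : 0 <= (0 : R) <= h by apply/andP; split=> //; exact: ltW.
have dphi t : 0 <= t <= h -> is_derive t 1 phi
    (P (x + t *: u + h *: v) - P (x + t *: u)).
  move=> th.
  have lineD (y : V) : differentiable G (y + t *: u) ->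
      is_derive t 1 (fun t => G (y + t *: u)) (P (y + t *: u)).
    move=> dGy.
    have dl : is_diff t (fun t : R => y + t *: u) (fun t : R => t *: u).
      by apply: is_diff_eq; rewrite add0r.
    have dl' : differentiable (fun t : R => y + t *: u) t by [].
    have dc := differentiable_comp dl' dGy.
    apply: DeriveDef; first by apply: diff_derivable; exact: dc.
    rewrite (derive_comp (1 : R) dl' dGy).
    by rewrite (deriveE _ dl') diff_val scale1r -deriveE.
  apply: is_deriveB.
    rewrite (_ : (fun t => _) = (fun t => G (x + h *: v + t *: u))).
      by rewrite addrAC; apply: lineD; rewrite addrAC; exact: dGs.
    by apply/funext => s; rewrite addrAC.
  by apply: lineD; have := dGs t 0 th zh; rewrite scale0r addr0.
have cphi : {within `[0, h], continuous phi}.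
  by apply: derivable_within_continuous => t /[!in_itv]/= /dphi[].
have dphi' t : t \in `]0, h[ ->
    is_derive t 1 phi (P (x + t *: u + h *: v) - P (x + t *: u)).
  by move=> /[!in_itv]/= /andP[/ltW t0 /ltW th]; apply: dphi; rewrite t0.
have [c /[!in_itv]/= /andP[c0 ch]] := MVT h0 dphi' cphi.
have chh : 0 <= c <= h by rewrite !ltW.
rewrite /phi scale0r addr0 subr0 => E.
rewrite (_ : _ - _ - _ + _ =
    (P (x + c *: u + h *: v) - P (x + c *: u)) * h); last by rewrite -E; ring.
set X := P _ - P _; have hn0 : h != 0 by rewrite gt_eqF.
rewrite (_ : _ - _ = (L v * h - X) / h); last by field.
rewrite normrM normfV (gtr0_norm h0) ler_pdivrMr// /X.
have A1 := Pd c h chh hh; have A2 := Pd c 0 chh zh.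
rewrite scale0r !addr0 in A2.
have LD : L (c *: u + h *: v) = L (c *: u) + L v * h.
  by rewrite linearD [L (h *: v)]linearZ mulrC.
have N1 : `|c *: u + h *: v| + `|c *: u| <= h * C.
  rewrite (le_trans (lerD (ler_normD _ _) (lexx _)))// !normrZ !gtr0_norm//.
  have : c * `|u| <= h * `|u| by rewrite ler_wpM2r// ltW.
  by rewrite /C; lra.
have A3 : e / C * (`|c *: u + h *: v| + `|c *: u|) <= e * h.
  by rewrite mulrAC ler_pdivrMr// -mulrA ler_pM2l.
apply: le_trans A3; rewrite mulrDr; apply: le_trans (lerD A1 A2).
rewrite -[X in _ <= _ + X]normrN; apply: le_trans (ler_normD _ _).
by rewrite distrC le_eqVlt; apply/orP; left; apply/eqP; congr `|_|; rewrite LD; ring.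
Unshelve. all: by end_near. Qed.

(** Both mixed derivatives are the limit of the same second difference, which is
symmetric in u and v. *)
Lemma young V (G : V -> R) x u v :
  (\near x, differentiable G x) ->
  differentiable ('D_u G) x -> differentiable ('D_v G) x ->
  'D_v ('D_u G) x = 'D_u ('D_v G) x.
Proof.
move=> dG du dv.
have Duv := second_difference_cvg dG du (v := v).
have Dvu := second_difference_cvg dG dv (v := u).
rewrite -(cvg_lim (@norm_hausdorff _ _) Duv) -(cvg_lim (@norm_hausdorff _ _) Dvu).
rewrite (_ : (fun h => _) = (fun h =>
  (G (x + h *: v + h *: u) - G (x + h *: v) - G (x + h *: u) + G x) / h ^+ 2))//.
apply/funext => h.
by rewrite [x + h *: v + _]addrAC [_ - G (_ + _ *: v) - _]addrAC.
Qed.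

End SecondOrder.

(** * Euclidean geometry of three-space *)

Section DotProduct.
Context {R : realType}.

Lemma dotpE n (u v : 'rV[R]_n) : dotp u v = \sum_(i < n) u 0 i * v 0 i.
Proof. by rewrite /dotp mxE; apply: eq_bigr => i _; rewrite mxE. Qed.

Lemma dotpC n (u v : 'rV[R]_n) : dotp u v = dotp v u.
Proof. by rewrite !dotpE; apply: eq_bigr => i _; rewrite mulrC. Qed.

Lemma dotpDl n (u v w : 'rV[R]_n) : dotp (u + v) w = dotp u w + dotp v w.
Proof. by rewrite /dotp mulmxDl mxE. Qed.

Lemma dotpZl n a (u v : 'rV[R]_n) : dotp (a *: u) v = a * dotp u v.
Proof. by rewrite /dotp -scalemxAl mxE. Qed.

Lemma dotpDr n (u v w : 'rV[R]_n) : dotp w (u + v) = dotp w u + dotp w v.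
Proof. by rewrite !(dotpC w) dotpDl. Qed.

Lemma dotpZr n a (u v : 'rV[R]_n) : dotp u (a *: v) = a * dotp u v.
Proof. by rewrite !(dotpC u) dotpZl. Qed.

Lemma dotp0l n (u : 'rV[R]_n) : dotp 0 u = 0.
Proof. by rewrite /dotp mul0mx mxE. Qed.

Lemma dotp0r n (u : 'rV[R]_n) : dotp u 0 = 0.
Proof. by rewrite dotpC dotp0l. Qed.

Lemma dotp_eq0 n (u : 'rV[R]_n) : (dotp u u == 0) = (u == 0).
Proof.
apply/eqP/eqP => [|->]; last exact: dotp0l.
rewrite dotpE => /eqP; rewrite psumr_eq0 => [/allP h|i _]; last exact: sqr_ge0.
apply/rowP => i; rewrite mxE; apply/eqP.
by have := h i (mem_index_enum _); rewrite /= mulf_eq0 orbb.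
Qed.

Definition gram n (a b : 'rV[R]_n) : R := dotp a a * dotp b b - dotp a b ^+ 2.

Lemma gramZr n r (a b : 'rV[R]_n) : gram a (r *: b) = r ^+ 2 * gram a b.
Proof. by rewrite /gram !dotpZl !dotpZr; ring. Qed.

(** If the Gram determinant vanishes, the component of b orthogonal to a
(scaled by |a|^2) has length zero. *)
Lemma gram_neq0 n (a b : 'rV[R]_n) :
  (forall x y, x *: a + y *: b = 0 -> x = 0 /\ y = 0) -> gram a b != 0.
Proof.
move=> free; apply/eqP => G0.
have a0 : dotp a a != 0.
  rewrite dotp_eq0; apply/eqP => a0.
  have [] := free 1 0; first by rewrite a0 scaler0 scale0r addr0.
  by move=> /eqP; rewrite oner_eq0.
have : dotp (- dotp a b *: a + dotp a a *: b) (- dotp a b *: a + dotp a a *: b) = 0.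
  rewrite !dotpDl !dotpDr !dotpZl !dotpZr (dotpC b a).
  transitivity (dotp a a * gram a b); first by rewrite /gram; ring.
  by rewrite G0 mulr0.
move/eqP; rewrite dotp_eq0 => /eqP /free[_ /eqP].
by rewrite (negPf a0).
Qed.

Lemma orthogonal_frame_eq0 (a b c m : 'rV[R]_3) :
  (forall x y, x *: a + y *: b = 0 -> x = 0 /\ y = 0) ->
  dotp c c = 1 -> dotp c a = 0 -> dotp c b = 0 ->
  dotp a m = 0 -> dotp b m = 0 -> dotp c m = 0 -> m = 0.
Proof.
move=> free cc ca cb am bm cm.
pose M : 'M[R]_3 := \matrix_(i < 3) nth 0 [:: a; b; c] i.
have mulM (v : 'rV[R]_3) : v *m M = v 0 0 *: a + v 0 1 *: b + v 0 2%:R *: c.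
  rewrite mulmx_sum_row !big_ord_recl big_ord0 addr0 addrA !rowK /=.
  by congr (_ *: _ + _ *: _ + _ *: _); congr (v _ _); apply/val_inj.
have Mu : M \in unitmx.
  rewrite unitmxE unitfE; apply/det0P => -[v v0]; rewrite mulM => E.
  have v2 : v 0 2%:R = 0.
    have := congr1 (dotp c) E.
    by rewrite !dotpDr !dotpZr ca cb cc dotp0r !mulr0 !add0r mulr1.
  have [v00 v01] : v 0 0 = 0 /\ v 0 1 = 0.
    by apply: free; rewrite -[RHS]E v2 scale0r addr0.
  case/eqP: v0; apply/rowP => -[[|[|[|i]]] // hi]; rewrite mxE.
  - by rewrite -[RHS]v00; congr (v _ _); apply/val_inj.
  - by rewrite -[RHS]v01; congr (v _ _); apply/val_inj.
  - by rewrite -[RHS]v2; congr (v _ _); apply/val_inj.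
have Mm : M *m m^T = 0.
  apply/colP => i; rewrite !mxE -[RHS](_ : dotp (row i M) m = 0).
    by rewrite dotpE; apply: eq_bigr => j _; rewrite !mxE.
  by rewrite rowK; case: i => -[|[|[|i]]].
by rewrite -[m]trmxK -[m^T](mulKmx Mu) Mm mulmx0 trmx0.
Qed.

End DotProduct.

(** * Curvature in coordinates *)

Section Curvature.
Context {R : realType}.
Local Notation plane := ('rV[R]_2).
Local Notation space := ('rV[R]_3).
Implicit Types (f nu : plane -> space) (q : plane).

Lemma det_mx22 (K : comNzRingType) (A : 'M[K]_2) :
  \det A = A 0 0 * A 1 1 - A 0 1 * A 1 0.
Proof.
rewrite (expand_det_row _ 0) !big_ord_recl big_ord0 addr0 /cofactor !det_mx11.
rewrite !mxE /= /bump /= expr0 expr1 mul1r mulN1r mulrN.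
by congr (_ * _ - _ * _); congr (A _ _); apply/val_inj.
Qed.

Lemma pt10 : pt 1 0 = 'e_0 :> plane.
Proof. by apply/rowP => -[[|[|//]] ?]; rewrite !mxE. Qed.

Lemma pt01 : pt 0 1 = 'e_1 :> plane.
Proof. by apply/rowP => -[[|[|//]] ?]; rewrite !mxE. Qed.

Lemma derive_plane (W : normedModType R) (F : plane -> W) q X :
  differentiable F q ->
  'D_X F q = X 0 0 *: 'D_(pt 1 0) F q + X 0 1 *: 'D_(pt 0 1) F q.
Proof.
move=> dF; rewrite !deriveE// -!linearZ -linearD; congr ('d F q _).
by apply/rowP => -[[|[|//]] i]; rewrite !mxE/= ?mulr0 ?mulr1 ?addr0 ?add0r;
  congr (X _ _); exact: val_inj.
Qed.

Lemma mul_jacobian_tr m n k (f : 'rV[R]_m -> 'rV[R]_k)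
    (g : 'rV[R]_n -> 'rV[R]_k) x y i j :
  differentiable f x -> differentiable g y ->
  ('J f x *m ('J g y)^T) i j = dotp ('D_('e_i) f x) ('D_('e_j) g y).
Proof.
move=> df dg; rewrite !deriveEjacobian// -!rowE dotpE mxE.
by apply: eq_bigr => l _; rewrite !mxE.
Qed.

Lemma first_form_entries f q : differentiable f q ->
  let M := first_form f q in
  [/\ M 0 0 = dotp ('D_(pt 1 0) f q) ('D_(pt 1 0) f q),
      M 0 1 = dotp ('D_(pt 1 0) f q) ('D_(pt 0 1) f q),
      M 1 0 = dotp ('D_(pt 0 1) f q) ('D_(pt 1 0) f q) &
      M 1 1 = dotp ('D_(pt 0 1) f q) ('D_(pt 0 1) f q)].
Proof.
by move=> df /=; rewrite !pt10 !pt01; split; exact: mul_jacobian_tr.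
Qed.

Lemma second_form_entries f nu q : differentiable f q -> differentiable nu q ->
  let M := second_form f nu q in
  [/\ M 0 0 = - dotp ('D_(pt 1 0) f q) ('D_(pt 1 0) nu q),
      M 0 1 = - dotp ('D_(pt 1 0) f q) ('D_(pt 0 1) nu q),
      M 1 0 = - dotp ('D_(pt 0 1) f q) ('D_(pt 1 0) nu q) &
      M 1 1 = - dotp ('D_(pt 0 1) f q) ('D_(pt 0 1) nu q)].
Proof.
by move=> df dn /=; rewrite !pt10 !pt01; split; rewrite mxE; congr (- _);
  exact: mul_jacobian_tr.
Qed.

Lemma gauss_curvatureE f nu q :
  differentiable f q -> differentiable nu q ->
  gauss_curvature f nu q =
  (dotp ('D_(pt 1 0) f q) ('D_(pt 1 0) nu q) *
   dotp ('D_(pt 0 1) f q) ('D_(pt 0 1) nu q) -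
   dotp ('D_(pt 1 0) f q) ('D_(pt 0 1) nu q) *
   dotp ('D_(pt 0 1) f q) ('D_(pt 1 0) nu q)) /
  gram ('D_(pt 1 0) f q) ('D_(pt 0 1) f q).
Proof.
move=> df dn; rewrite /gauss_curvature.
have [] := first_form_entries df; have [] := second_form_entries df dn.
generalize (first_form f q) (second_form f nu q).
generalize ('D_(pt 1 0) f q) ('D_(pt 0 1) f q) ('D_(pt 1 0) nu q) ('D_(pt 0 1) nu q).
move=> A B M N I II; rewrite !det_mx22 => -> -> -> -> -> -> -> ->.
by rewrite /gram (dotpC B A) !mulrNN expr2.
Qed.

Lemma jacobian_comp m n k (h : 'rV[R]_m -> 'rV[R]_n) (f : 'rV[R]_n -> 'rV[R]_k) x :
  differentiable h x -> differentiable f (h x) ->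
  'J (f \o h) x = 'J h x *m 'J f (h x).
Proof.
move=> dh df; apply/row_matrixP => i; rewrite !rowE mulmxA.
rewrite -(deriveEjacobian 'e_i (differentiable_comp dh df)).
rewrite -(deriveEjacobian 'e_i dh) (derive_comp 'e_i dh df).
by rewrite /jacobian mul_rV_lin1.
Qed.

Lemma det_form_quotient (K : fieldType) n m (J : 'M[K]_n) (F N : 'M[K]_(n, m)) :
  J \in unitmx ->
  \det (- ((J *m F) *m (J *m N)^T)) / \det ((J *m F) *m (J *m F)^T) =
  \det (- (F *m N^T)) / \det (F *m F^T).
Proof.
have congrE G : (J *m F) *m (J *m G)^T = J *m (F *m G^T) *m J^T.
  by rewrite trmx_mul !mulmxA.
have detE S : \det (J *m S *m J^T) = \det J ^+ 2 * \det S.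
  by rewrite !det_mulmx det_tr mulrAC -expr2.
rewrite unitmxE unitfE => J0; rewrite !congrE -mulNmx -mulmxN !detE.
by rewrite -mulf_div divff ?expf_neq0// mul1r.
Qed.

(** Both fundamental forms are multiplied by the squared Jacobian determinant. *)
Lemma gauss_curvature_comp f nu (h : plane -> plane) w :
  differentiable h w -> differentiable f (h w) -> differentiable nu (h w) ->
  'J h w \in unitmx ->
  gauss_curvature (f \o h) (nu \o h) w = gauss_curvature f nu (h w).
Proof.
move=> dh df dn Ju; rewrite /gauss_curvature /second_form /first_form.
rewrite (jacobian_comp dh df) (jacobian_comp dh dn).
exact: det_form_quotient.
Qed.

Lemma principal_curvature_comp f nu (h : plane -> plane) w k :
  differentiable h w -> differentiable f (h w) -> differentiable nu (h w) ->
  'J h w \in unitmx ->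
  principal_curvature f nu (h w) k -> principal_curvature (f \o h) (nu \o h) w k.
Proof.
move=> dh df dn Ju [X X0 E]; exists (X *m invmx ('J h w)).
  by apply: contra_neq X0 => E0; rewrite -[X](mulmxKV Ju) E0 mul0mx.
set Y := X *m _; have dhX : 'D_Y h w = X.
  by rewrite (deriveEjacobian Y dh) (mulmxKV Ju).
have dE (F : plane -> space) : differentiable F (h w) -> 'd (F \o h) w Y = 'd F (h w) X.
  move=> dF; apply: etrans (esym (deriveE Y (differentiable_comp dh dF))) _.
  by apply: etrans (derive_comp Y dh dF) _; rewrite dhX.
by apply: etrans (dE _ dn) _; apply: etrans E _; congr (_ *: _); exact/esym/dE.
Qed.

(** The characteristic equation det (II - k I) = 0 of the two fundamental forms,
solved for det II.  Divided by gram A B it reads K = k k2: the factor of k on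
the right is, up to gram A B, the other principal curvature. *)
Lemma principal_curvature_eq f nu q k :
  differentiable f q -> differentiable nu q -> principal_curvature f nu q k ->
  let A := 'D_(pt 1 0) f q in let B := 'D_(pt 0 1) f q in
  let M := 'D_(pt 1 0) nu q in let N := 'D_(pt 0 1) nu q in
  dotp A M * dotp B N - dotp A N * dotp B M =
  k * (dotp A B * (dotp A N + dotp B M) - dotp A M * dotp B B - dotp A A * dotp B N
       - k * gram A B).
Proof.
move=> df dn [X X0 eigX].
have : 'D_X nu q = - k *: 'D_X f q.
  apply: etrans (deriveE X dn) _; apply: etrans eigX _.
  by congr (_ *: _); exact/esym/deriveE.
rewrite (derive_plane X df) (derive_plane X dn).
have : X 0 0 != 0 \/ X 0 1 != 0.
  have [x0|x0] := eqVneq (X 0 0) 0; last by left.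
  right; apply: contra_neq X0 => x1; apply/rowP => -[[|[|//]] i2]; rewrite mxE.
    by rewrite -[RHS]x0; congr (X _ _); exact: val_inj.
  by rewrite -[RHS]x1; congr (X _ _); exact: val_inj.
(* Pairing the eigenvector equation with A and with B gives a homogeneous linear
   system for the coordinates (a, b) of X, so its determinant vanishes. *)
move: (X 0 0) (X 0 1) => a b ab /=.
generalize ('D_(pt 1 0) f q) ('D_(pt 0 1) f q) ('D_(pt 1 0) nu q) ('D_(pt 0 1) nu q).
move=> A B M N eqn.
have eqA := congr1 (dotp A) eqn; have eqB := congr1 (dotp B) eqn.
rewrite !(dotpDr, dotpZr) in eqA eqB; rewrite (dotpC B A) in eqB.
rewrite /gram; move: eqA eqB.
move: (dotp A A) (dotp A B) (dotp B B) (dotp A M) (dotp A N) (dotp B M) (dotp B N).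
move=> E F G am an bm bn eqA eqB.
suff : (am + k * E) * (bn + k * G) - (an + k * F) * (bm + k * F) = 0.
  by move=> h; apply/eqP; rewrite -subr_eq0; apply/eqP; rewrite -[RHS]h; ring.
have pa : a * (am + k * E) + b * (an + k * F) = 0 by rewrite mulrDr mulrDr; lra.
have pb : a * (bm + k * F) + b * (bn + k * G) = 0 by rewrite mulrDr mulrDr; lra.
move: pa pb; move: (am + _) (bn + _) (an + _) (bm + _) => p s q' r pa pb.
case: ab => /mulfI; apply; rewrite mulr0.
  transitivity (s * (a * p + b * q') - q' * (a * r + b * s)); first by ring.
  by rewrite pa pb !mulr0 subr0.
transitivity (p * (a * r + b * s) - r * (a * p + b * q')); first by ring.
by rewrite pa pb !mulr0 subr0.
Qed.

End Curvature.

(** * Limits along a ray *)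

Section RayLimits.
Context {R : realType}.
Local Notation plane := ('rV[R]_2).
Local Notation space := ('rV[R]_3).

Lemma cvg_dotp T (F : set_system T) {FF : Filter F} n (u v : T -> 'rV[R]_n)
    (a b : 'rV[R]_n) :
  u @ F --> a -> v @ F --> b -> dotp (u x) (v x) @[x --> F] --> dotp a b.
Proof.
move=> ua vb; under eq_cvg do rewrite dotpE.
rewrite dotpE; apply: cvg_big => [|i _]; first exact: add_continuous.
have coord (w : T -> 'rV[R]_n) (c : 'rV[R]_n) :
    w @ F --> c -> w x 0 i @[x --> F] --> c 0 i.
  by move=> wc; exact: (continuous_cvg _ (@coord_continuous _ _ _ 0 i c) wc).
by apply: cvgM; exact: coord.
Qed.

Lemma cvg_ray (W : normedModType R) (F : plane -> W) w :
  {for 0, continuous F} -> F (r *: w) @[r --> (0 : R)^'+] --> F 0.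
Proof.
move=> Fc; apply: (continuous_cvg _ Fc).
apply: cvg_at_right_filter; rewrite -[X in _ --> X](scale0r w).
by apply: cvgZr_tmp; exact: cvg_id.
Qed.

Lemma cvg_ray_quotient (W : normedModType R) (F : plane -> W) w :
  differentiable F 0 -> F 0 = 0 ->
  r^-1 *: F (r *: w) @[r --> (0 : R)^'+] --> 'D_w F 0.
Proof.
move=> dF F0; have /cvg_dnbhs_at_right := diff_derivable (v := w) dF.
rewrite (_ : (fun r => r^-1 *: F (r *: w)) =
             (fun h => h^-1 *: ((F \o shift 0) (h *: w) - F 0)))//.
by apply/funext => h; rewrite /= F0 subr0 addr0.
Qed.

(** When g_u, g_v, n_u, n_v are A, r B, M, N and k is a principal curvature, this
is r times the other one: r times the sum of the roots of the characteristic
equation, minus r k.  In terms of B = g_v / r it stays bounded as r tends to 0. *)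
Definition scaled_curvature (r k : R) (A B M N : space) : R :=
  (dotp A B * (dotp A N + r * dotp B M) - r * (dotp A M * dotp B B)
    - dotp A A * dotp B N - r * k * gram A B) / gram A B.

Lemma scaled_curvatureE r k (A B M N : space) : r != 0 ->
  dotp A M * dotp (r *: B) N - dotp A N * dotp (r *: B) M =
  k * (dotp A (r *: B) * (dotp A N + dotp (r *: B) M)
       - dotp A M * dotp (r *: B) (r *: B) - dotp A A * dotp (r *: B) N
       - k * gram A (r *: B)) ->
  (dotp A M * dotp (r *: B) N - dotp A N * dotp (r *: B) M) / gram A (r *: B) =
  k / r * scaled_curvature r k A B M N.
Proof.
move=> r0 ->; rewrite /scaled_curvature.
rewrite gramZr !dotpZl !dotpZr; move: (gram A B) => G.
have [->|G0] := eqVneq G 0; first by rewrite mulr0 invr0 !mulr0.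
by field; rewrite r0 G0.
Qed.

(** Several terms carry a factor r; one more disappears in the limit because
a, the limit of g_u, is orthogonal to n, the limit of n_v. *)
Lemma cvg_scaled_curvature (A B M N : R -> space) (k : R -> R)
    (a b m n : space) (k0 : R) :
  A @ 0^'+ --> a -> B @ 0^'+ --> b -> M @ 0^'+ --> m -> N @ 0^'+ --> n ->
  k @ 0^'+ --> k0 -> dotp a n = 0 -> gram a b != 0 ->
  scaled_curvature r (k r) (A r) (B r) (M r) (N r) @[r --> 0^'+] -->
  - (dotp a a * dotp b n) / gram a b.
Proof.
move=> Aa Bb Mm Nn kk an0 g0.
have r0 : r @[r --> (0 : R)^'+] --> (0 : R).
  by apply: cvg_at_right_filter; exact: cvg_id.
have gc : gram (A r) (B r) @[r --> 0^'+] --> gram a b.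
  apply: cvgB; first by apply: cvgM; exact: cvg_dotp.
  by under eq_cvg do rewrite expr2; rewrite expr2; apply: cvgM; exact: cvg_dotp.
rewrite /scaled_curvature (_ : - _ / _ =
  (dotp a b * (dotp a n + 0 * dotp b m) - 0 * (dotp a m * dotp b b)
    - dotp a a * dotp b n - 0 * k0 * gram a b) / gram a b); last first.
  by rewrite an0; congr (_ / _); ring.
have AN := cvg_dotp Aa Nn; have AM := cvg_dotp Aa Mm; have AA := cvg_dotp Aa Aa.
have AB := cvg_dotp Aa Bb; have BB := cvg_dotp Bb Bb; have BM := cvg_dotp Bb Mm.
have BN := cvg_dotp Bb Nn.
apply: cvgM; last exact: cvgV g0 gc.
apply: cvgB; last exact: cvgM (cvgM r0 kk) gc.
apply: cvgB; last by apply: cvgM; [exact: AA|exact: BN].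
apply: cvgB; last by apply: cvgM; [exact: r0|apply: cvgM; [exact: AM|exact: BB]].
apply: cvgM; first exact: AB.
by apply: cvgD; [exact: AN|apply: cvgM; [exact: r0|exact: BM]].
Qed.

End RayLimits.

(** * Derivatives of vector-valued maps *)

Section VectorCalculus.
Context {R : realType}.
Implicit Types V W : normedModType R.

Lemma near_eq_cst_derive V W (F : V -> W) c x v :
  (\near x, F x = c) -> 'D_v F x = 0.
Proof. by move=> Fc; rewrite (@near_eq_derive _ _ _ F (cst c))// derive_cst. Qed.

Lemma derive_vanish_ray (W : normedModType R) (F : 'rV[R]_2 -> W) w :
  differentiable F 0 -> F 0 = 0 ->
  (\forall r \near (0 : R)^'+, F (r *: w) = 0) -> 'D_w F 0 = 0.
Proof.
move=> dF F0 Fr; have lim1 := cvg_ray_quotient (w := w) dF F0.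
have lim2 : r^-1 *: F (r *: w) @[r --> (0 : R)^'+] --> (0 : W).
  by apply: cvg_near_cst; near=> r; rewrite (near Fr r)// scaler0.
rewrite -(cvg_lim (@norm_hausdorff _ _) lim1).
exact: (cvg_lim (@norm_hausdorff _ _) lim2).
Unshelve. all: by end_near. Qed.

Lemma derive_dotp V n (F G : V -> 'rV[R]_n) x v :
  differentiable F x -> differentiable G x ->
  'D_v (fun y => dotp (F y) (G y)) x = dotp ('D_v F x) (G x) + dotp (F x) ('D_v G x).
Proof.
move=> dF dG.
have dFi i : derivable (fun y => F y 0 i) x v.
  by apply: diff_derivable; exact: differentiable_coordF.
have dGi i : derivable (fun y => G y 0 i) x v.
  by apply: diff_derivable; exact: differentiable_coordF.
rewrite (_ : (fun y => _) = \sum_(i < n) (fun y => F y 0 i * G y 0 i)); last first.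
  by apply/funext => y; rewrite fct_sumE dotpE.
rewrite derive_sum; last by move=> i; apply: derivableM.
rewrite !dotpE -big_split/=; apply: eq_bigr => i _.
rewrite (@deriveM _ _ (fun y => F y 0 i) (fun y => G y 0 i))//.
rewrite (derive_coordF i v dF) (derive_coordF i v dG) addrC.
by congr (_ + _); exact: mulrC.
Qed.

Lemma young_rV V n (F : V -> 'rV[R]_n) x u v :
  (\near x, differentiable F x) ->
  differentiable ('D_u F) x -> differentiable ('D_v F) x ->
  'D_v ('D_u F) x = 'D_u ('D_v F) x.
Proof.
move=> dF du dv; apply/rowP => j.
apply: etrans (esym (derive_coordF j v du)) _.
apply: etrans _ (derive_coordF j u dv).
pose Fj y := F y 0 j.
have dFj : \near x, differentiable Fj x.
  by apply: filterS dF => y; exact: differentiable_coordF.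
have DE w : \near x, ('D_w F x) 0 j = 'D_w Fj x.
  by apply: filterS dF => y dFy; rewrite -(derive_coordF j w dFy).
have dD w : differentiable ('D_w F) x -> differentiable ('D_w Fj) x.
  by move=> dw; apply: near_eq_differentiable (DE w) _; exact: differentiable_coordF.
apply: etrans (near_eq_derive v (DE u)) _.
apply: etrans _ (esym (near_eq_derive u (DE v))).
exact: (young dFj (dD u du) (dD v dv)).
Qed.

(** Where the first derivative of h along v vanishes, the second derivative of h
is a vector: the term with the second derivative of f drops out. *)
Lemma derive2_comp_critical V m k (A : set V) (B : set 'rV[R]_m)
    (h : V -> 'rV[R]_m) (f : 'rV[R]_m -> 'rV[R]_k) x v :
  open A -> A x -> diff2_on A h -> diff2_on B f -> (forall y, A y -> B (h y)) ->
  'D_v h x = 0 ->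
  'D_v ('D_v (f \o h)) x = 'd f (h x) ('D_v ('D_v h) x).
Proof.
move=> oA Ax d2h d2f AB hv0; have [dh d2hx] := d2h x Ax.
have [df d2fx] := d2f _ (AB x Ax).
have [_ d2c] := diff2_comp oA d2h d2f AB Ax.
have Anear : \near x, A x by exact: open_nbhs_nbhs.
rewrite diff_rV//; apply/rowP => j; rewrite summxE.
apply: etrans (esym (derive_coordF j v (d2c v))) _.
pose F (i : 'I_m) y := ('D_v h y) 0 i; pose G (i : 'I_m) y := ('D_('e_i) f (h y)) 0 j.
have dF i : differentiable (F i) x by apply: differentiable_coordF; exact: d2hx.
have dG i : differentiable (G i) x.
  apply: (@differentiable_coordF _ _ _ ('D_('e_i) f \o h)).
  exact: differentiable_comp.
have FG : \near x, ('D_v (f \o h) x) 0 j = (\sum_(i < m) (F i * G i)) x.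
  apply: filterS Anear => y Ay; have [dfy _] := d2f _ (AB y Ay).
  have [dhy _] := d2h y Ay; rewrite (derive_comp v dhy dfy) diff_rV// summxE fct_sumE.
  by apply: eq_bigr => i _; rewrite mxE.
rewrite (near_eq_derive _ FG) derive_sum; last first.
  by move=> i; apply: derivableM; exact: diff_derivable.
apply: eq_bigr => i _; rewrite deriveM; try exact: diff_derivable.
have -> : F i x = 0 by rewrite /F hv0 mxE.
rewrite scale0r add0r mxE mulrC -[RHS]/(G i x *: _); congr (_ *: _).
exact: derive_coordF.
Qed.

End VectorCalculus.

(** * Cuspidal edges *)

Section Diffeo.
Context {R : realType}.

Lemma diffeo_jacobian_unit n (A B : set 'rV[R]_n) (h : 'rV[R]_n -> 'rV[R]_n) x :
  diffeo_on A B h -> A x -> 'J h x \in unitmx.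
Proof.
move=> [oA oB sh [k [sk hA hB]]] Ax.
have [dh _] := smooth_diff2 sh Ax.
have [dk _] := smooth_diff2 sk (proj1 (hA x Ax)).
apply: (proj1 (@mulmx1_unit _ _ _ ('J k (h x)) _)).
rewrite -(jacobian_comp dh dk); apply/row_matrixP => i; rewrite !rowE mulmx1.
apply: etrans (esym (deriveEjacobian 'e_i (differentiable_comp dh dk))) _.
rewrite (@near_eq_derive _ _ _ _ id); first by rewrite derive_id.
have : \near x, A x by exact: open_nbhs_nbhs.
by apply: filterS => y /hA[].
Qed.

Lemma unit_jacobian_inj m (h : 'rV[R]_m -> 'rV[R]_m) x X :
  differentiable h x -> 'J h x \in unitmx -> 'D_X h x = 0 -> X = 0.
Proof.
move=> dh Ju; rewrite (deriveEjacobian X dh) => E.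
by rewrite -[X](mulmxK Ju) E mul0mx.
Qed.

End Diffeo.

Section CuspidalEdge.
Context {R : realType}.
Local Notation plane := ('rV[R]_2).
Local Notation space := ('rV[R]_3).
Local Notation e1 := (pt 1 0 : plane).
Local Notation e2 := (pt 0 1 : plane).

Lemma pt_eq0 (a b : R) : pt a b = 0 -> a = 0 /\ b = 0.
Proof.
by move=> /rowP E; have := E 0; have := E 1; rewrite !mxE.
Qed.

Lemma e2_neq0 : e2 != 0.
Proof. by apply/eqP => /pt_eq0[_ /eqP]; rewrite oner_eq0. Qed.

(** Let (x, y) = tau be the source coordinates of the normal form, in which the
front becomes (x, y^2, y^3).  As g_v = 0 at the origin, x_v = 0 there, and the
Jacobian of tau leaves x_u and y_v nonzero.  The differential of Psi sends
g_u to (x_u, 0, 0) and, the origin being critical along v, sends g_vv to a vector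
with second component 2 y_v^2; these are independent. *)
Lemma cuspidal_edge_free (V : set plane) (B : set space) (g : plane -> space)
    (Psi : space -> space) (tau : plane -> plane) :
  open V -> V 0 -> diff2_on V g -> diff2_on B Psi -> diff2_on V tau ->
  (forall w, V w -> B (g w)) ->
  (forall w, V w -> Psi (g w) = standard_cuspidal_edge (tau w)) ->
  tau 0 = 0 -> 'J tau 0 \in unitmx -> 'D_e2 g 0 = 0 ->
  forall a b, a *: 'D_e1 g 0 + b *: 'D_e2 ('D_e2 g) 0 = 0 -> a = 0 /\ b = 0.
Proof.
move=> oV V0 d2g d2P d2t gB PE t0 Ju gv0 a b ab.
have Vnear : nbhs (0 : plane) V by exact: open_nbhs_nbhs.
have [dg d2g0] := d2g 0 V0; have [dt d2t0] := d2t 0 V0.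
have [dP _] := d2P _ (gB 0 V0).
have [dc d2c] := diff2_comp oV d2g d2P gB V0.
pose x w := tau w 0 0; pose y w := tau w 0 1.
have dxy i w : V w -> differentiable (fun w => tau w 0 i) w.
  by move=> /d2t[dtw _]; exact: differentiable_coordF.
have y0 : y 0 = 0 by rewrite /y t0 mxE.
have c0E w : V w -> (Psi \o g) w 0 0 = x w by move=> Vw; rewrite /= PE// mxE.
have c1E w : V w -> (Psi \o g) w 0 1 = y w ^+ 2 by move=> Vw; rewrite /= PE// mxE.
have Dc0 X : ('D_X (Psi \o g) 0) 0 0 = 'D_X x 0.
  apply: etrans (esym (derive_coordF 0 X dc)) _.
  by apply: near_eq_derive; apply: filterS Vnear.
have Dy2 X w : V w -> 'D_X (fun w => y w ^+ 2) w = 2 * y w * 'D_X y w.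
  move=> Vw; rewrite (_ : (fun w => _) = y * y); last first.
    by apply/funext => v; rewrite expr2.
  have dy : derivable y w X by apply: diff_derivable; exact: dxy.
  apply: etrans (deriveM dy dy) _.
  by rewrite -[LHS]/(y w * 'D_X y w + y w * 'D_X y w); ring.
have Dc1 X w : V w -> ('D_X (Psi \o g) w) 0 1 = 2 * y w * 'D_X y w.
  move=> Vw; have [dcw _] := diff2_comp oV d2g d2P gB Vw.
  apply: etrans (esym (derive_coordF 1 X dcw)) _; rewrite -Dy2//.
  apply: near_eq_derive; have : \near w, V w by exact: open_nbhs_nbhs.
  by apply: filterS.
have DtE X : 'D_X tau 0 = pt ('D_X x 0) ('D_X y 0).
  apply/rowP => -[[|[|//]] i2]; rewrite mxE/=.
    by rewrite /x (derive_coordF _ _ dt); congr (_ _ _); exact: val_inj.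
  by rewrite /y (derive_coordF _ _ dt); congr (_ _ _); exact: val_inj.
have xv0 : 'D_e2 x 0 = 0.
  by rewrite -Dc0 (derive_comp e2 dg dP) gv0 linear0 mxE.
have yv0 : 'D_e2 y 0 != 0.
  apply/eqP => yv0; have /eqP := e2_neq0; apply.
  apply: (unit_jacobian_inj dt Ju); rewrite DtE xv0 yv0.
  by apply/rowP => i; rewrite !mxE; case: ifP.
have xu0 : 'D_e1 x 0 != 0.
  apply/eqP => xu0.
  have /pt_eq0[] : pt ('D_e2 y 0) (- 'D_e1 y 0) = 0; last first.
    by move/eqP; rewrite (negPf yv0).
  apply: (unit_jacobian_inj dt Ju); rewrite (derive_plane _ dt) !DtE xv0 xu0.
  generalize ('D_e1 y 0) ('D_e2 y 0) => yu yv; clear.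
  by apply/rowP => -[[|[|//]] i2]; rewrite !mxE/=; ring.
have DD1 : ('D_e2 ('D_e2 (Psi \o g)) 0) 0 1 = 2 * ('D_e2 y 0) ^+ 2.
  apply: etrans (esym (derive_coordF 1 e2 (d2c e2))) _.
  rewrite (@near_eq_derive _ _ _ _ (2 *: (y * 'D_e2 y))); last first.
    by apply: filterS Vnear => w Vw; rewrite Dc1// -mulrA.
  have dyv : differentiable ('D_e2 y) 0.
    have : differentiable (fun w => ('D_e2 tau w) 0 1) 0.
      by apply: differentiable_coordF; exact: d2t0.
    apply: near_eq_differentiable; apply: filterS Vnear => w Vw.
    by have [dtw _] := d2t _ Vw; exact/esym/derive_coordF.
  have dy : derivable y 0 e2 by apply: diff_derivable; exact: dxy.
  have dyv' := diff_derivable (v := e2) dyv.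
  apply: etrans (deriveZ 2 (derivableM dy dyv')) _; rewrite (deriveM dy dyv').
  by rewrite y0 scale0r add0r expr2.
have L := congr1 ('d Psi (g 0)) ab.
rewrite linear0 linearD !linearZ/= in L.
rewrite -(derive2_comp_critical oV V0 d2g d2P gB gv0) in L.
rewrite -(derive_comp e1 dg dP) in L.
have b0 : b = 0.
  have := congr1 (fun v : space => v 0 1) L.
  rewrite !mxE DD1 Dc1// y0 mulr0 mul0r mulr0 add0r => /eqP.
  by rewrite !mulf_eq0 pnatr_eq0/= orbb (negPf yv0) orbF => /eqP.
split => //; have := congr1 (fun v : space => v 0 0) L.
rewrite b0 scale0r addr0 !mxE Dc0 => /eqP.
by rewrite mulf_eq0 (negPf xu0) orbF => /eqP.
Qed.

End CuspidalEdge.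

(** * A front along its singular curve *)

Section FrontAlongEdge.
Context {R : realType}.
Local Notation plane := ('rV[R]_2).
Local Notation space := ('rV[R]_3).
Local Notation e1 := (pt 1 0 : plane).
Local Notation e2 := (pt 0 1 : plane).

Lemma scale_pt (r a b : R) : r *: pt a b = pt (r * a) (r * b).
Proof. by apply/rowP => i; rewrite !mxE; case: ifP. Qed.

Lemma cvg_pt_ray (w : plane) : r *: w @[r --> (0 : R)^'+] --> (0 : plane).
Proof.
apply: cvg_at_right_filter; rewrite -[X in _ --> X](scale0r w).
by apply: cvgZr_tmp; exact: cvg_id.
Qed.

Variables (V : set plane) (g n : plane -> space).
Hypotheses (oV : open V) (V0 : V 0) (d2g : diff2_on V g) (d2n : diff2_on V n)
  (gv_axis : forall u, V (pt u 0) -> 'D_e2 g (pt u 0) = 0)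
  (nn : forall w, V w -> dotp (n w) (n w) = 1)
  (gn : forall w X, V w -> dotp ('D_X g w) (n w) = 0).

Let gu := 'D_e1 g 0.
Let gvv := 'D_e2 ('D_e2 g) 0.
Let nv := 'D_e2 n 0.

Lemma gv0 : 'D_e2 g 0 = 0.
Proof.
have p0 : (0 : plane) = pt 0 0 by apply/rowP => i; rewrite !mxE; case: ifP.
by rewrite p0; apply: gv_axis; rewrite -p0.
Qed.

Lemma guv0 : 'D_e1 ('D_e2 g) 0 = 0.
Proof.
have [_ d2g0] := d2g V0.
apply: derive_vanish_ray => //; first exact: gv0.
have : \forall r \near 0^'+, V (r *: e1).
  by apply: (cvg_pt_ray e1); exact: open_nbhs_nbhs.
by apply: filterS => r; rewrite scale_pt mulr1 mulr0; exact: gv_axis.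
Qed.

Lemma derive_gv w : 'D_w ('D_e2 g) 0 = w 0 1 *: gvv.
Proof.
have [_ d2g0] := d2g V0.
by rewrite (derive_plane w (d2g0 e2)) guv0 scaler0 add0r.
Qed.

Lemma derive_gn X Y :
  dotp ('D_Y ('D_X g) 0) (n 0) + dotp ('D_X g 0) ('D_Y n 0) = 0.
Proof.
have [_ d2g0] := d2g V0; have [dn _] := d2n V0.
rewrite -(derive_dotp Y (d2g0 X) dn); apply: (@near_eq_cst_derive _ _ _ _ 0).
have : nbhs (0 : plane) V by exact: open_nbhs_nbhs.
by apply: filterS => w; exact: gn.
Qed.

(** Differentiating g_u . n = 0 along v gives g_u . n_v = - g_uv . n, and g_uv is
also the derivative along the u-axis of g_v, which vanishes there. *)
Lemma gu_nv : dotp gu nv = 0.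
Proof.
have [_ d2g0] := d2g V0.
rewrite -[RHS](derive_gn e1 e2) (young_rV _ (d2g0 e1) (d2g0 e2)).
  by rewrite guv0 dotp0l add0r.
have : nbhs (0 : plane) V by exact: open_nbhs_nbhs.
by apply: filterS => w /d2g[].
Qed.

(** The vectors g_u, g_vv, n form a basis (both g_u and g_vv are orthogonal to n),
and n_v is orthogonal to g_u and to n; so it cannot be orthogonal to g_vv too. *)
Lemma gvv_nv : (forall a b, a *: gu + b *: gvv = 0 -> a = 0 /\ b = 0) ->
  nv != 0 -> dotp gvv nv != 0.
Proof.
move=> free; apply: contra_neq => hm.
have [dn _] := d2n V0.
apply: (orthogonal_frame_eq0 free (nn V0) _ _ _ hm).
- by rewrite dotpC; exact: gn.
- have := derive_gn e2 e2; rewrite gv0 dotp0l addr0 => <-; exact: dotpC.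
- exact: gu_nv.
- have : 'D_e2 (fun w => dotp (n w) (n w)) 0 = 0.
    apply: (@near_eq_cst_derive _ _ _ _ (1 : R)).
    have : nbhs (0 : plane) V by exact: open_nbhs_nbhs.
    by apply: filterS.
  rewrite (derive_dotp e2 dn dn) (dotpC nv) => E.
  by move/eqP: E; rewrite -mulr2n mulrn_eq0 => /eqP.
Qed.

End FrontAlongEdge.

(** * The Gaussian curvature along rays *)

Section CurvatureOnRays.
Context {R : realType}.
Local Notation plane := ('rV[R]_2).
Local Notation space := ('rV[R]_3).
Local Notation e1 := (pt 1 0 : plane).
Local Notation e2 := (pt 0 1 : plane).

Variables (V : set plane) (g n : plane -> space) (k : plane -> R).
Hypotheses (oV : open V) (V0 : V 0) (d2g : diff2_on V g) (d2n : diff2_on V n)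
  (gv_axis : forall u, V (pt u 0) -> 'D_e2 g (pt u 0) = 0)
  (nn : forall w, V w -> dotp (n w) (n w) = 1)
  (gn : forall w X, V w -> dotp ('D_X g w) (n w) = 0)
  (nv_neq0 : 'D_e2 n 0 != 0)
  (gu_gvv_free : forall a b, a *: 'D_e1 g 0 + b *: 'D_e2 ('D_e2 g) 0 = 0 ->
    a = 0 /\ b = 0)
  (dk : differentiable k 0)
  (k_principal : nbhs (0 : plane) [set w : plane | w 0 1 != 0 ->
    principal_curvature g n w (k w)]).

(** The limit at the origin of v times the unbounded principal curvature. *)
Definition curvature_residue : R :=
  - (dotp ('D_e1 g 0) ('D_e1 g 0) * dotp ('D_e2 ('D_e2 g) 0) ('D_e2 n 0)) /
  gram ('D_e1 g 0) ('D_e2 ('D_e2 g) 0).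

Lemma curvature_residue_neq0 : curvature_residue != 0.
Proof.
rewrite mulf_neq0// ?invr_neq0 ?gram_neq0// oppr_eq0 mulf_neq0//.
  rewrite dotp_eq0; apply/eqP => gu0.
  have [] := gu_gvv_free (a := 1) (b := 0).
    by rewrite gu0 scaler0 scale0r addr0.
  by move=> /eqP; rewrite oner_eq0.
exact: (gvv_nv oV V0 d2g d2n).
Qed.

(** The function S is r times the unbounded principal curvature. *)
Lemma gauss_curvature_ray (w : plane) : w 0 1 != 0 ->
  exists2 S : R -> R, S @ 0^'+ --> curvature_residue / w 0 1 &
    \forall r \near 0^'+,
      gauss_curvature g n (r *: w) = k (r *: w) / r * S r.
Proof.
move=> w1.
have [dg d2g0] := d2g V0; have [dn d2n0] := d2n V0.
have g0 := gv0 V0 gv_axis.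
pose A r := 'D_e1 g (r *: w); pose B r := r^-1 *: 'D_e2 g (r *: w).
pose M r := 'D_e1 n (r *: w); pose N r := 'D_e2 n (r *: w).
exists (fun r => scaled_curvature r (k (r *: w)) (A r) (B r) (M r) (N r)).
  have -> : curvature_residue / w 0 1 =
    - (dotp ('D_e1 g 0) ('D_e1 g 0) * dotp (w 0 1 *: 'D_e2 ('D_e2 g) 0) ('D_e2 n 0)) /
    gram ('D_e1 g 0) (w 0 1 *: 'D_e2 ('D_e2 g) 0).
    have G0 := gram_neq0 gu_gvv_free; rewrite /curvature_residue.
    rewrite gramZr dotpZl; move: (gram _ _) G0 => G G0.
    move: (dotp _ _) (dotp _ _) (w 0 1) w1 => E F s s0.
    by field; rewrite s0 G0.
  apply: (@cvg_scaled_curvature _ A B M N (fun r => k (r *: w))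
    _ _ ('D_e1 n 0) _ (k 0)).
  - exact: (cvg_ray w (differentiable_continuous (d2g0 e1))).
  - by rewrite -(derive_gv oV V0 d2g gv_axis); exact: cvg_ray_quotient.
  - exact: (cvg_ray w (differentiable_continuous (d2n0 e1))).
  - exact: (cvg_ray w (differentiable_continuous (d2n0 e2))).
  - exact: (cvg_ray w (differentiable_continuous dk)).
  - exact: (gu_nv oV V0 d2g d2n).
  - apply: gram_neq0 => a b; rewrite scalerA => /gu_gvv_free[-> /eqP].
    by rewrite mulf_eq0 (negPf w1) orbF => /eqP.
have ray := cvg_pt_ray w.
have Vr : \forall r \near 0^'+, V (r *: w).
  by apply: (ray V); exact: open_nbhs_nbhs.
have pr : \forall r \near 0^'+,
    (r *: w) 0 1 != 0 -> principal_curvature g n (r *: w) (k (r *: w)).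
  exact: (ray _ k_principal).
have rpos := nbhs_right_gt (0 : R).
apply: filterS3 Vr pr rpos => r Vr pr rpos.
have r0 : r != 0 by rewrite gt_eqF.
have [dgr _] := d2g Vr; have [dnr _] := d2n Vr.
have rB : 'D_e2 g (r *: w) = r *: B r by rewrite /B scalerA divff// scale1r.
have := pr _; rewrite mxE mulf_neq0// => /(_ isT) pc.
have := principal_curvature_eq dgr dnr pc.
rewrite (gauss_curvatureE dgr dnr) /= rB; exact: scaled_curvatureE.
Qed.

(** The factor k / r tends to the derivative of k along the ray. *)
Lemma cvg_gauss_curvature_ray (w : plane) : w 0 1 != 0 -> k 0 = 0 ->
  gauss_curvature g n (r *: w) @[r --> 0^'+] -->
  (w 0 0 * 'D_e1 k 0 + w 0 1 * 'D_e2 k 0) * (curvature_residue / w 0 1).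
Proof.
move=> w1 k0; have [S SL KE] := gauss_curvature_ray w1.
have kL := cvg_ray_quotient (w := w) dk k0.
rewrite (derive_plane w dk) in kL.
apply: cvg_trans (cvgM kL SL); apply: near_eq_cvg.
by apply: filterS KE => r ->; rewrite mulrC [k _ / r]mulrC -mulrC.
Qed.

(** If K converges then r K tends to 0, while r K = k S tends to k(0) times a
nonzero constant. *)
Lemma cvg_gauss_curvature_ray_eq0 (w : plane) (l : R) : w 0 1 != 0 ->
  gauss_curvature g n (r *: w) @[r --> 0^'+] --> l -> k 0 = 0.
Proof.
move=> w1 Kl; have [S SL KE] := gauss_curvature_ray w1.
have r0 : r @[r --> (0 : R)^'+] --> (0 : R).
  by apply: cvg_at_right_filter; exact: cvg_id.
have kc := cvg_ray w (differentiable_continuous dk).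
have lim2 : k (r *: w) * S r @[r --> (0 : R)^'+] --> k 0 * (curvature_residue / w 0 1).
  exact: cvgM kc SL.
have lim1 : r * gauss_curvature g n (r *: w) @[r --> (0 : R)^'+] --> (0 : R).
  by rewrite -[X in _ --> X](mul0r l); exact: cvgM r0 Kl.
have lim3 : k (r *: w) * S r @[r --> (0 : R)^'+] --> (0 : R).
  apply: (cvg_trans _ lim1); apply: near_eq_cvg.
  near=> r; have r1 : 0 < r by near: r; exact: nbhs_right_gt.
  by rewrite [LHS]/= (near KE r)// mulrA mulrCA divff ?gt_eqF// mulr1.
have /eqP : k 0 * (curvature_residue / w 0 1) = 0.
  exact: (cvg_unique (@Rhausdorff R) lim2 lim3).
have c0 : curvature_residue / w 0 1 != 0.
  by rewrite mulf_neq0 ?invr_neq0 ?curvature_residue_neq0.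
by rewrite mulf_eq0 (negPf c0) orbF => /eqP.
Unshelve. all: by end_near. Qed.

End CurvatureOnRays.

Section Angles.
Context {R : realType}.

Lemma sin_neq0 (t : R) : angles_but [:: 0; pi] t -> sin t != 0.
Proof.
move=> [/andP[t0 t2]]; rewrite !inE negb_or => /andP[tn0 tnpi].
have [tpi|tpi|E] := ltgtP t pi; last by rewrite E eqxx in tnpi.
  by rewrite gt_eqF// sin_gt0_pi// lt_neqAle eq_sym tn0 t0.
rewrite -[t](subrK pi) sinDpi oppr_eq0 gt_eqF// sin_gt0_pi//.
by rewrite subr_gt0 tpi/= ltrBlDr -mulr2n -mulr_natl.
Qed.

(** The numbers 1, 1/2, 1/3, ... are angles in ]0, pi[, and a finite list cannot
contain them all. *)
Lemma ex_angle (s : seq R) : exists2 t, angles_but s t & sin t != 0.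
Proof.
pose h (i : nat) : R := i.+1%:R^-1.
have h0 i : 0 < h i by rewrite invr_gt0.
have h1 i : h i < pi.
  rewrite (lt_le_trans _ (pi_ge2 R))// (@le_lt_trans _ _ 1) ?ltr1n//.
  by rewrite invf_le1// ler1n.
have hi : injective h by move=> i j /invr_inj /eqP; rewrite eqr_nat => /eqP[].
have [/allP sub|/allPn[_ /mapP[i _ ->] his]] :=
    boolP (all (mem s) (map h (iota 0 (size s).+1))).
  have := uniq_leq_size (s1 := map h (iota 0 (size s).+1)) (s2 := s).
  by rewrite map_inj_uniq// iota_uniq size_map size_iota ltnn => /(_ isT sub).
exists (h i); last by rewrite gt_eqF// sin_gt0_pi// h0 h1.
split => //; rewrite (ltW (h0 i))/= (lt_trans (h1 i))// mulr_natl mulr2n.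
by rewrite ltrDl pi_gt0.
Qed.

End Angles.

(** * Fronts in adapted coordinates *)

Section AdaptedFront.
Context {R : realType}.
Local Notation plane := ('rV[R]_2).
Local Notation space := ('rV[R]_3).
Local Notation e1 := (pt 1 0 : plane).
Local Notation e2 := (pt 0 1 : plane).

Lemma pt_coord (w : plane) : w = pt (w 0 0) (w 0 1).
Proof.
by apply/rowP => -[[|[|//]] i]; rewrite mxE/=; congr (w _ _); exact: val_inj.
Qed.

Lemma pt00 : pt 0 0 = 0 :> plane.
Proof. by apply/rowP => i; rewrite !mxE; case: ifP. Qed.

Lemma diffeo_inv n (A B : set 'rV[R]_n) (h : 'rV[R]_n -> 'rV[R]_n) :
  diffeo_on A B h -> exists k, [/\ diffeo_on B A k,
    forall x, A x -> B (h x) /\ k (h x) = x & forall y, B y -> A (k y) /\ h (k y) = y].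
Proof.
move=> [oA oB sh [k [sk hA hB]]]; exists k; split => //; split => //.
by exists h.
Qed.

Lemma open_preimage_in (V W : normedModType R) (A : set V) (B : set W) (h : V -> W) :
  open A -> open B -> (forall x, A x -> {for x, continuous h}) ->
  open [set x | A x /\ B (h x)].
Proof.
move=> oA oB hc; rewrite openE => x [Ax Bx]; apply: filterI.
  exact: open_nbhs_nbhs.
by apply: (hc x Ax); exact: open_nbhs_nbhs.
Qed.

Variables (Sigma : set plane) (f nu : plane -> space) (p : plane)
  (V U : set plane) (phi : plane -> plane).
Hypotheses (hf : front_with_normal Sigma f nu) (hcusp : cuspidal_edge Sigma f p)
  (hphi : adapted_coordinates Sigma f p V U phi).

Let g := f \o phi.
Let n := nu \o phi.

Lemma adapted_diff2 : [/\ open V, V 0, diff2_on V phi, diff2_on V g & diff2_on V n].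
Proof.
have [hd US [V0 _] _ _] := hphi; have [oV oU sphi [psi [_ hV _]]] := hd.
have [sf sn _ _ _] := hf; have dphi := smooth_diff2 sphi.
have VS w : V w -> Sigma (phi w) by move=> /hV[/US].
by split => //; apply: (diff2_comp oV dphi _ VS); exact: smooth_diff2.
Qed.

Lemma adapted_in w : V w -> Sigma (phi w).
Proof.
by have [[_ _ _ [psi [_ hV _]]] US _ _ _] := hphi => /hV[/US].
Qed.

Lemma adapted_diff w : V w ->
  [/\ differentiable phi w, differentiable f (phi w) & differentiable nu (phi w)].
Proof.
move=> Vw; have [oV V0 dphi _ _] := adapted_diff2; have [sf sn _ _ _] := hf.
have Sw := adapted_in Vw.
split; first by have [] := dphi w Vw.
  exact: (sf [::]).
exact: (sn [::]).
Qed.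

Lemma adapted_normal w X : V w -> dotp ('D_X g w) (n w) = 0.
Proof.
move=> Vw; have [dphi df _] := adapted_diff Vw; have [_ _ _ fn _] := hf.
by rewrite (derive_comp X dphi df); exact: fn (adapted_in Vw).
Qed.

Lemma adapted_unit w : V w -> dotp (n w) (n w) = 1.
Proof. by move=> Vw; have [_ _ nn _ _] := hf; exact: nn (adapted_in Vw). Qed.

Lemma adapted_axis u : V (pt u 0) -> 'D_e2 g (pt u 0) = 0.
Proof. by have [_ _ _ _] := hphi; exact. Qed.

Lemma adapted_jacobian w : V w -> 'J phi w \in unitmx.
Proof. by have [hd _ _ _ _] := hphi; exact: diffeo_jacobian_unit hd. Qed.

(** By the front condition d(f, nu) is injective, and it sends the image of the
v-direction to (g_v, n_v) = (0, n_v). *)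
Lemma adapted_nv : 'D_e2 n 0 != 0.
Proof.
have [oV V0 _ _ _] := adapted_diff2; have [dphi df dn] := adapted_diff V0.
apply/eqP => nv0; have /eqP := @e2_neq0 R; apply.
apply: (unit_jacobian_inj dphi (adapted_jacobian V0)).
have [_ _ _ _ imm] := hf; apply: (imm _ (adapted_in V0)); rewrite linear0.
rewrite (diff_pair df dn); congr (_, _).
  by apply: etrans (esym (derive_comp e2 dphi df)) _; exact: (gv0 V0 adapted_axis).
by apply: etrans (esym (derive_comp e2 dphi dn)) _.
Qed.

Lemma adapted_free a b :
  a *: 'D_e1 g 0 + b *: 'D_e2 ('D_e2 g) 0 = 0 -> a = 0 /\ b = 0.
Proof.
have [oV V0 dphi2 dg2 _] := adapted_diff2; have [_ _ [_ phi0] _ _] := hphi.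
have [Vc [Uc [phic [A [B [Phi [hc [Vc0 phic0] _ hPhi fE]]]]]]] := hcusp.
have [psic [hpsic hVc hUc]] := diffeo_inv hc.
have [Psi [hPsi hA hB]] := diffeo_inv hPhi.
have [_ oUc _ _] := hc.
pose tau := psic \o phi; pose V' := [set w | V w /\ Uc (phi w)].
have Ucp : Uc (phi 0) by rewrite phi0 -phic0; have [] := hVc 0 Vc0.
have oV' : open V'.
  apply: open_preimage_in => // w Vw; apply: differentiable_continuous.
  by have [] := dphi2 w Vw.
have VV' (W' : normedModType R) (F : plane -> W') : diff2_on V F -> diff2_on V' F.
  by move=> dF w [Vw _]; exact: dF.
have [_ _ spsic _] := hpsic; have [_ _ sPsi _] := hPsi.
have d2t : diff2_on V' tau.
  apply: (diff2_comp oV' (VV' _ _ dphi2) (smooth_diff2 spsic)).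
  by move=> w [].
have V'0 : V' 0 by [].
have fphi w : V' w -> A (standard_cuspidal_edge (tau w)) /\
    g w = Phi (standard_cuspidal_edge (tau w)).
  move=> [Vw Uw]; have [Vt tE] := hUc _ Uw.
  by have := fE _ Vt; rewrite tE.
apply: (cuspidal_edge_free oV' V'0 (VV' _ _ dg2) (smooth_diff2 sPsi) d2t).
- by move=> w /fphi[Aw ->]; have [] := hA _ Aw.
- by move=> w /fphi[Aw ->]; have [] := hA _ Aw.
- by rewrite /tau /= phi0 -phic0; have [] := hVc 0 Vc0.
- have [dphi _] := dphi2 0 V0; have [dpsi _] := smooth_diff2 spsic Ucp.
  rewrite /tau (jacobian_comp dphi dpsi).
  rewrite unitmx_mul; apply/andP; split; first exact: (adapted_jacobian V0).
  exact: (diffeo_jacobian_unit hpsic Ucp).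
- exact: (gv0 V0 adapted_axis).
Qed.

Variable kappa : plane -> R.
Hypothesis hkappa : bounded_principal_curvature Sigma f nu p kappa.

Lemma adapted_kappa : differentiable (kappa \o phi) 0 /\
  nbhs (0 : plane) [set w : plane | w 0 1 != 0 ->
    principal_curvature g n w ((kappa \o phi) w)].
Proof.
have [oV V0 _ _ _] := adapted_diff2; have [dphi _ _] := adapted_diff V0.
have [_ _ [_ phi0] sing _] := hphi; have [N [oN Np NS sk kp]] := hkappa.
split.
  by apply: differentiable_comp => //; rewrite phi0; exact: (sk [::]).
have nV : nbhs (0 : plane) V by exact: open_nbhs_nbhs.
have nN : nbhs (0 : plane) (phi @^-1` N).
  by apply: (differentiable_continuous dphi); rewrite phi0; exact: open_nbhs_nbhs.
apply: filterS2 nV nN => w Vw Nw /= w1.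
have [dphiw dfw dnw] := adapted_diff Vw.
apply: principal_curvature_comp => //; first exact: adapted_jacobian.
apply: kp => //; rewrite (pt_coord w) in Vw *.
by move=> /(sing _ _ Vw) /eqP; rewrite (negPf w1).
Qed.

Let D := V `\` phi @^-1` singular_set Sigma f.
Let K := gauss_curvature f nu \o phi.

Lemma ray_in_domain (c s : R) : s != 0 -> \forall r \near 0^'+, D (pt (r * c) (r * s)).
Proof.
move=> s0; have [oV V0 _ _ _] := adapted_diff2; have [_ _ _ sing _] := hphi.
have Vr : \forall r \near 0^'+, V (r *: pt c s).
  have ray := cvg_pt_ray (pt c s).
  by apply: (ray V); exact: open_nbhs_nbhs.
have rpos := nbhs_right_gt (0 : R).
apply: filterS2 Vr rpos => r Vr rpos; rewrite scale_pt in Vr; split => //.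
move=> /(sing _ _ Vr) /eqP; rewrite mulf_eq0 (negPf s0) orbF.
by rewrite gt_eqF.
Qed.

Lemma cvg_K_ray (c s l : R) : s != 0 ->
  gauss_curvature g n (r *: pt c s) @[r --> (0 : R)^'+] --> l <->
  K (pt (r * c) (r * s)) @[r --> (0 : R)^'+] --> l.
Proof.
move=> s0.
have E : \forall r \near 0^'+,
    gauss_curvature g n (r *: pt c s) = K (pt (r * c) (r * s)).
  apply: filterS (ray_in_domain c s0) => r [Vr _]; rewrite scale_pt.
  have [dphi df dn] := adapted_diff Vr.
  exact: (gauss_curvature_comp dphi df dn (adapted_jacobian Vr)).
have E' : \forall r \near 0^'+,
    K (pt (r * c) (r * s)) = gauss_curvature g n (r *: pt c s).
  by apply: filterS E => r /esym.
split => lim; apply: cvg_trans lim; apply: near_eq_cvg.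
  exact: E.
exact: E'.
Qed.

Lemma rationally_bounded_kappa0 : rationally_bounded D K -> kappa p = 0.
Proof.
move=> [s [l [hl _]]]; have [t st t0] := ex_angle s.
have [oV V0 _ d2g d2n] := adapted_diff2; have [dk kp] := adapted_kappa.
have [_ Kl'] := hl t st.
have Kl := (cvg_K_ray (cos t) (l t) t0).2 Kl'.
have [_ _ [_ phi0] _ _] := hphi; rewrite -phi0.
apply: (cvg_gauss_curvature_ray_eq0 oV V0 d2g d2n adapted_axis adapted_unit
  adapted_normal adapted_nv adapted_free dk kp _ Kl).
by rewrite mxE.
Qed.

Let a := 'D_e1 (kappa \o phi) 0.
Let b := 'D_e2 (kappa \o phi) 0.

Definition ray_curvature (t : R) : R :=
  (cos t * a + sin t * b) * (curvature_residue g n / sin t).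

Lemma kappa0_ray_limits : kappa p = 0 ->
  has_ray_limits D K [:: 0; pi] ray_curvature.
Proof.
move=> kp0; have [oV V0 _ d2g d2n] := adapted_diff2; have [dk kp] := adapted_kappa.
have [_ _ [_ phi0] _ _] := hphi; rewrite -phi0 in kp0.
split=> [t /sin_neq0 t0|].
  split; first exact: ray_in_domain.
  apply: (cvg_K_ray (cos t) _ t0).1.
  have := cvg_gauss_curvature_ray oV V0 d2g d2n adapted_axis
    adapted_normal adapted_free dk kp (w := pt (cos t) (sin t)).
  by rewrite !mxE/=; exact.
apply: continuous_in_subspaceT => t /[!inE] /sin_neq0 t0.
have ct := @continuous_cos R t; have st := @continuous_sin R t.
apply: cvgM.
  by apply: cvgD; apply: cvgM => //; exact: cvg_cst.
by apply: cvgM; [exact: cvg_cst|exact: cvgV].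
Qed.

(** The coordinates delta of the singular curve stay on the u-axis, so their
velocity at 0 is (d, 0), with d <> 0 because the curve is regular; the derivative
d k_u of kappa along the curve vanishes by contact. *)
Lemma contact_kappa_u gamma :
  singular_curve Sigma f p gamma -> contact 1 gamma 0 kappa -> a = 0.
Proof.
move=> [e e0 [sg dg0 g0 [N [oN Np NE]]]] ct.
have [oV V0 _ _ _] := adapted_diff2; have [dphi _ _] := adapted_diff V0.
have [hd _ [_ phi0] sing _] := hphi.
have [dk _] := adapted_kappa.
have [psi [hpsi hV hU]] := diffeo_inv hd.
have [_ oU _ _] := hd; have [_ _ spsi _] := hpsi.
have z_in : [set` `]- e, e[] (0 : R) by rewrite /= in_itv/= oppr_lt0 e0.
have dgam : differentiable gamma 0 by exact: (sg [::]).
have Up : U p by rewrite -phi0; have [] := hV 0 V0.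
pose delta := psi \o gamma.
have delta0 : delta 0 = 0 by rewrite /delta /= g0 -phi0; have [] := hV 0 V0.
have dpsi : differentiable psi (gamma 0) by rewrite g0; exact: (spsi [::]).
have ddel : differentiable delta 0 by exact: differentiable_comp.
have Un : \forall t \near (0 : R), U (gamma t).
  by apply: (differentiable_continuous dgam); rewrite g0; exact: open_nbhs_nbhs.
have en : \forall t \near (0 : R), [set` `]- e, e[] t.
  by apply: open_nbhs_nbhs; split => //; exact: interval_open.
have dE : \forall t \near (0 : R), V (delta t) /\ phi (delta t) = gamma t.
  by apply: filterS Un => t /hU.
have del1 : 'D_1 delta 0 0 1 = 0.
  apply: etrans (esym (derive_coordF 1 (1 : R) ddel)) _.
  apply: (@near_eq_cst_derive _ _ _ _ (0 : R)).
  apply: filterS2 dE en => t [Vt pt'] et.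
  have : (N `&` singular_set Sigma f) (gamma t) by rewrite NE; exists t.
  have Vc : V (pt (delta t 0 0) (delta t 0 1)) by rewrite -pt_coord.
  by rewrite -pt' => -[_]; have := (sing _ _ Vc).1; rewrite -pt_coord; exact.
have kd : 'D_('D_1 delta 0) (kappa \o phi) 0 = 0.
  have dk' : differentiable (kappa \o phi) (delta 0) by rewrite delta0.
  have chain : 'D_1 ((kappa \o phi) \o delta) 0 =
      'D_('D_1 delta 0) (kappa \o phi) (delta 0).
    exact: etrans (derive_comp (1 : R) ddel dk') (esym (deriveE _ dk')).
  have ct1 : 'D_1 (kappa \o gamma) 0 = 0.
    by have := ct 1 (leqnn 1); rewrite derive1n1 derive1E.
  rewrite delta0 in chain; apply: etrans (esym chain) _; apply: etrans _ ct1.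
  by apply: near_eq_derive; apply: filterS dE => t [_ E]; rewrite /= E.
move: kd; rewrite (derive_plane _ dk) del1 scale0r addr0 => /eqP.
rewrite scaler_eq0 => /orP[/eqP del00|/eqP//].
have d0 : 'D_1 delta 0 = 0 by rewrite (pt_coord ('D_1 delta 0)) del00 del1 pt00.
have := dg0 0; rewrite oppr_lt0 e0 => /(_ isT); rewrite derive1E.
have dphi' : differentiable phi (delta 0) by rewrite delta0.
rewrite -(@near_eq_derive _ _ _ (phi \o delta)); last first.
  by apply: filterS dE => t [].
by rewrite (derive_comp _ ddel dphi') d0 linear0 eqxx.
Qed.

End AdaptedFront.

Theorem corollary3p7 (R : realType) (Sigma : set 'rV[R]_2)
    (f nu : 'rV[R]_2 -> 'rV[R]_3) (p : 'rV[R]_2) (kappa : 'rV[R]_2 -> R)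
    (V U : set 'rV[R]_2) (phi : 'rV[R]_2 -> 'rV[R]_2)
    (hSigma : domain Sigma) (hf : front_with_normal Sigma f nu)
    (hp : Sigma p) (hcusp : cuspidal_edge Sigma f p)
    (hkappa : bounded_principal_curvature Sigma f nu p kappa)
    (hphi : adapted_coordinates Sigma f p V U phi) :
  let D := V `\` phi @^-1` singular_set Sigma f in
  let K := gauss_curvature f nu \o phi in
  (rationally_bounded D K <-> parabolic_curve kappa p) /\
  (forall gamma : R -> 'rV[R]_2,
     singular_curve Sigma f p gamma -> contact 1 gamma 0 kappa ->
     rationally_continuous D K).
Proof.
move=> D K; split; first split.
- exact: (rationally_bounded_kappa0 hf hcusp hphi hkappa).
- by move=> kp; do 2 eexists; exact: (kappa0_ray_limits hf hcusp hphi hkappa kp).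
move=> gamma hgamma ct.
have kp : kappa p = 0.
  by have [e _ [_ _ <- _]] := hgamma; exact: (ct 0).
have ku := contact_kappa_u hf hphi hkappa hgamma ct.
exists [:: 0; pi], (ray_curvature f nu phi kappa).
split; first exact: (kappa0_ray_limits hf hcusp hphi hkappa kp).
have const t : angles_but [:: 0; pi] t -> ray_curvature f nu phi kappa t =
    'D_(pt 0 1) (kappa \o phi) 0 * curvature_residue (f \o phi) (nu \o phi).
  by move=> /sin_neq0 t0; rewrite /ray_curvature ku; field.
by move=> t1 t2 h1 h2; rewrite !const.
Qed.
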